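(* For every $n\geq 2$ there exists a subset $\mathcal{I}^n$ of $G^n\bigl(\tfrac{1}{n+1}\bigr)$ of cardinality $|\mathcal{I}^n|=2^n$ such that $\mathcal{I}^n$ illuminates every 1-symmetric convex body in $\mathbb{R}^n$.
   Context: A convex body in $\mathbb{R}^n$ is a compact convex set with non-empty interior. A convex body $B\subset\mathbb{R}^n$ is called 1-symmetric if $(x_1,\ldots,x_n)\in B$ implies $(\epsilon_1x_{\sigma(1)},\ldots,\epsilon_nx_{\sigma(n)})\in B$ for all signs $\epsilon_i\in\{\pm1\}$ and all permutations $\sigma$ of $[n]=\{1,\ldots,n\}$. A direction is a non-zero vector of $\mathbb{R}^n$. A direction $d$ illuminates a boundary point $x$ of a convex body $K$ if there is $\varepsilon>0$ with $x+\varepsilon d\in\operatorname{int}K$. A set $\mathcal{D}$ of directions illuminates $K$ if every boundary point of $K$ is illuminated by at least one $d\in\mathcal{D}$. Let $e_1,\ldots,e_n$ be the standard basis of $\mathbb{R}^n$. For $\delta\in(0,1)$, $G^n(\delta)$ is the set of all $d\in\mathbb{R}^n$ for which there is $i\in[n]$ with $|d_i|=1$ and $|d_j|=\delta$ for all $j\in[n]\setminus\{i\}$ (i.e. $d=\pm e_i+\sum_{j\neq i}\pm\delta e_j$ with arbitrary signs). *)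

(* Defs.v *)
From mathcomp Require Import all_boot all_order all_fingroup all_algebra.
From mathcomp Require Import all_classical reals topology normedtype convex.
Set Implicit Arguments.
Unset Strict Implicit.
Unset Printing Implicit Defensive.
Import Order.TTheory GRing.Theory Num.Theory.
Import numFieldNormedType.Exports.
Local Open Scope classical_set_scope.
Local Open Scope ring_scope.

(* Points of R^n are row vectors; the library's topology on 'rV[R]_n is the
   product topology, i.e. the usual Euclidean one. *)

Definition convex_body (R : realType) (n : nat) (K : set 'rV[R]_n) : Prop :=
  [/\ compact K, convex_set (K : set (convex_lmodType 'rV[R]_n))
    & interior K !=set0].

Definition boundary (R : realType) (n : nat) (K : set 'rV[R]_n) :
    set 'rV[R]_n :=
  closure K `\` interior K.

(* The sign eps_i is encoded as (-1) ^+ eps i with eps i a boolean. *)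
Definition one_symmetric (R : realType) (n : nat) (B : set 'rV[R]_n) : Prop :=
  forall (x : 'rV[R]_n) (eps : 'I_n -> bool) (s : 'S_n),
    B x -> B (\row_i ((-1) ^+ eps i * x ord0 (s i))).

Definition illuminates_point (R : realType) (n : nat) (K : set 'rV[R]_n)
    (d x : 'rV[R]_n) : Prop :=
  exists2 e : R, 0 < e & interior K (x + e *: d).

Definition illuminates (R : realType) (n : nat) (D K : set 'rV[R]_n) : Prop :=
  (forall d, D d -> d != 0) /\
  (forall x, boundary K x -> exists2 d, D d & illuminates_point K d x).

Definition Gset (R : realType) (n : nat) (delta : R) : set 'rV[R]_n :=
  [set d | exists i : 'I_n,
     `|d ord0 i| = 1 /\ forall j : 'I_n, j != i -> `|d ord0 j| = delta].
Arguments Gset {R} n delta.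

(* Main.v *)
Require Import Defs.
From mathcomp Require Import all_boot all_order all_fingroup all_algebra.
From mathcomp Require Import all_classical reals topology normedtype convex.
From mathcomp Require Import interval_inference lra ring.
Set Implicit Arguments.
Unset Strict Implicit.
Unset Printing Implicit Defensive.
Import Order.TTheory GRing.Theory Num.Theory.
Import numFieldNormedType.Exports.
Local Open Scope classical_set_scope.
Local Open Scope ring_scope.

(** There is one direction [d_s] for each of the [2 ^ n] sign patterns [s]; the
    choice to be made is the position of its entry of modulus 1.  Let [delta]
    be the modulus of the other entries.

    Let [x] be a nonzero point of [B] with support [S], and let [d] be a
    direction whose signs on [S] are opposite to those of [x] and whose large
    entry sits at some [i] in [S].  Then [d] illuminates [x]
    ([illuminates_support]).  Indeed a short step along [d] shrinks every
    coordinate in [S], the [i]-th by [e], and creates coordinates of size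
    [e * delta] outside [S].  Averaging [x] with copies of itself in which
    coordinate [i] is swapped with a zero coordinate puts a slightly larger
    mass, [e / n], on each zero coordinate and costs coordinate [i] less than
    [e] in all, because there are fewer than [n] zeros
    ([one_symmetric_spread]).  So the step ends at a point that is strictly
    smaller, coordinate by coordinate, than a point of [B], and such points are
    interior ([one_symmetric_interior_box]).

    It remains to place the large entries so that, for every nonempty [S] and
    every choice of signs on [S], some extension [s] of these signs has its
    large entry in [S].  Putting the large entry of [d_s] at the end of the
    initial constant run of [s] achieves this ([extend_with_run_end_in]): on
    the complement of [S], give the coordinates before [min S] the same sign as
    [min S] and those after [min S] the opposite sign.  The initial run then
    reaches [min S] and cannot end outside [S].

    The origin, the only point with empty support, is interior
    ([one_symmetric_interior0]), hence not a boundary point. *)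

(** * Placing the large entry: the end of the initial run *)

Definition constant_upto (n : nat) (s : {ffun 'I_n.+1 -> bool}) :
    pred 'I_n.+1 :=
  fun k => [forall j : 'I_n.+1, (j <= k)%N ==> (s j == s ord0)].

Definition run_end (n : nat) (s : {ffun 'I_n.+1 -> bool}) : 'I_n.+1 :=
  [arg max_(k > ord0 | constant_upto s k) (k : nat)]%N.

Lemma run_endP (n : nat) (s : {ffun 'I_n.+1 -> bool}) :
  constant_upto s (run_end s) /\
  forall k, constant_upto s k -> (k <= run_end s)%N.
Proof.
rewrite /run_end; case: arg_maxnP => //.
by apply/forallP => j; apply/implyP; rewrite leqn0 => /eqP j0;
  apply/eqP; congr (s _); apply/val_inj.
Qed.

(** The combinatorial heart: the run of the extension below contains the least
    element [m] of [S], and every index beyond [m] on which it can stop lies in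
    [S], since the other ones carry the sign opposite to that of the run. *)
Lemma extend_with_run_end_in (n : nat) (S : pred 'I_n.+1)
    (sigma : 'I_n.+1 -> bool) (k0 : 'I_n.+1) : S k0 ->
  exists s : {ffun 'I_n.+1 -> bool},
    (forall j, S j -> s j = sigma j) /\ S (run_end s).
Proof.
move=> Sk0; case: (arg_minnP (fun k : 'I_n.+1 => k : nat) Sk0) => m Sm mmin.
pose s := [ffun j : 'I_n.+1 =>
  if S j then sigma j else sigma m (+) (m < j)%N].
exists s; split=> [j Sj|]; first by rewrite ffunE Sj.
have s_le (j : 'I_n.+1) : (j <= m)%N -> s j = sigma m.
  move=> jm; rewrite ffunE; case: ifPn => [Sj|_].
    by congr sigma; apply/val_inj/eqP; rewrite eqn_leq jm mmin.
  by rewrite ltnNge jm addbF.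
have s0 : s ord0 = sigma m by apply: s_le.
have [runP run_max] := run_endP s.
have m_run : (m <= run_end s)%N.
  apply: run_max; apply/forallP => j; apply/implyP => jm.
  by rewrite s0 s_le.
move/forallP/(_ (run_end s)): runP; rewrite leqnn s0 /= ffunE.
case: ifPn => // nS.
case: ltngtP m_run => // [_ _|/val_inj mE _]; first by case: (sigma m).
by rewrite -mE Sm in nS.
Qed.

(** * Unconditional convex sets *)

Lemma convex_set_comb (R : realType) (n : nat) (B : set 'rV[R]_n)
    (x y : 'rV[R]_n) (t : R) :
  convex_set (B : set (convex_lmodType 'rV[R]_n)) ->
  B x -> B y -> 0 <= t -> t <= 1 -> B (t *: x + (1 - t) *: y).
Proof.
move=> cB Bx By t0 t1.
have := cB x y (Itv01 t0 t1); rewrite !inE; exact.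
Qed.

(** A coordinate [u] with [`|u| <= `|x i|] lies on the segment between [x i] and
    [- x i], so the new point is a convex combination of [x] and its reflection
    in coordinate [i]. *)
Lemma one_symmetric_solid_coord (R : realType) (n : nat) (B : set 'rV[R]_n)
    (x : 'rV[R]_n) (i : 'I_n) (u : R) :
  convex_set (B : set (convex_lmodType 'rV[R]_n)) -> one_symmetric B ->
  B x -> `|u| <= `|x ord0 i| ->
  B (\row_j (if j == i then u else x ord0 j)).
Proof.
move=> cB sB Bx ux.
have [xi0|xi0] := eqVneq (x ord0 i) 0.
  move: ux; rewrite xi0 normr0 normr_le0 => /eqP ->.
  by congr (B _): Bx; apply/rowP => j; rewrite !mxE; case: eqP => // ->.
have := sB x (fun j => j == i) 1%g Bx.
set y := (\row_j _) => By.
(* [t] solves [t * x i - (1 - t) * x i = u]. *)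
pose t := (1 + u / x ord0 i) / 2.
have : `|u / x ord0 i| <= 1.
  by rewrite normrM normfV ler_pdivrMr ?normr_gt0 // mul1r.
rewrite ler_norml => /andP[q1 q2].
have t0 : 0 <= t by rewrite /t; lra.
have t1 : t <= 1 by rewrite /t; lra.
have := convex_set_comb cB Bx By t0 t1.
congr (B _); apply/rowP => j; rewrite !mxE perm1.
case: eqP => [->|_]; first by rewrite /t expr1; field.
by rewrite expr0; ring.
Qed.

Lemma one_symmetric_solid (R : realType) (n : nat) (B : set 'rV[R]_n)
    (x y : 'rV[R]_n) :
  convex_set (B : set (convex_lmodType 'rV[R]_n)) -> one_symmetric B ->
  B x -> (forall j, `|y ord0 j| <= `|x ord0 j|) -> B y.
Proof.
move=> cB sB Bx yx.
have replaced (r : seq 'I_n) :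
    B (\row_j (if j \in r then y ord0 j else x ord0 j)).
  elim: r => [|i r IH].
    by congr (B _): Bx; apply/rowP => j; rewrite mxE.
  have le_i : `|y ord0 i| <=
      `|(\row_j (if j \in r then y ord0 j else x ord0 j)) ord0 i|.
    by rewrite mxE; case: ifP.
  have := one_symmetric_solid_coord cB sB IH le_i.
  congr (B _); apply/rowP => j; rewrite !mxE inE.
  by case: eqP => [->|].
have := replaced (enum 'I_n); congr (B _); apply/rowP => j.
by rewrite mxE mem_enum.
Qed.

Lemma one_symmetric_interior_box (R : realType) (n : nat) (B : set 'rV[R]_n)
    (x y : 'rV[R]_n) :
  convex_set (B : set (convex_lmodType 'rV[R]_n)) -> one_symmetric B ->
  B x -> (forall j, `|y ord0 j| < `|x ord0 j|) -> interior B y.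
Proof.
move=> cB sB Bx yx.
suff : nbhs y [set z : 'rV[R]_n | forall j, `|z ord0 j| < `|x ord0 j|].
  apply: filterS => z zx; apply: (one_symmetric_solid cB sB Bx) => j.
  exact/ltW/zx.
have coord_lt j : nbhs y [set z : 'rV[R]_n | `|z ord0 j| < `|x ord0 j|].
  have /cvg_norm : (fun z : 'rV[R]_n => z ord0 j) @ y --> y ord0 j.
    exact: coord_continuous.
  by move/cvgr_lt; apply.
exact: filter_forall coord_lt.
Qed.

(** An open set contains a point without zero coordinates, and the open box
    spanned by such a point is a neighbourhood of the origin. *)
Lemma one_symmetric_interior0 (R : realType) (n : nat) (B : set 'rV[R]_n) :
  convex_body B -> one_symmetric B -> interior B 0.
Proof.
move=> [_ cB [p /nbhs_ballP[e /= e0 pB]]] sB.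
pose w := \row_j (p ord0 j + (if 0 <= p ord0 j then e / 2 else - (e / 2))).
apply: (one_symmetric_interior_box (x := w) cB sB).
  apply: pB; split=> // i j; rewrite /w /ball /= ord1 mxE opprD addNKr.
  by rewrite normrN; case: ifP => _; rewrite ?normrN ger0_norm; lra.
move=> j; rewrite !mxE normr0 normr_gt0.
by case: ifP => [|/negbT]; rewrite -?ltNge => H; apply/eqP; lra.
Qed.

(** * Moving mass onto the zero coordinates *)

(** The new point lies on the segment from [x] to its copy with coordinates [i]
    and [z] exchanged, the fraction [s / x i] of the way along. *)
Lemma one_symmetric_transfer (R : realType) (n : nat) (B : set 'rV[R]_n)
    (x : 'rV[R]_n) (i z : 'I_n) (s : R) :
  convex_set (B : set (convex_lmodType 'rV[R]_n)) -> one_symmetric B ->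
  B x -> x ord0 z = 0 -> 0 < x ord0 i -> 0 <= s -> s <= x ord0 i ->
  B (\row_j (if j == i then x ord0 i - s else
             if j == z then s else x ord0 j)).
Proof.
move=> cB sB Bx xz xi s0 sx.
have By := sB x (fun=> false) (tperm i z) Bx.
set y := (\row_j _) in By.
pose t := 1 - s / x ord0 i.
have q0 : 0 <= s / x ord0 i by rewrite divr_ge0 // ltW.
have q1 : s / x ord0 i <= 1 by rewrite ler_pdivrMr // mul1r.
have t0 : 0 <= t by rewrite /t; lra.
have t1 : t <= 1 by rewrite /t; lra.
have xi' : x ord0 i != 0 by rewrite gt_eqF.
have := convex_set_comb cB Bx By t0 t1.
congr (B _); apply/rowP => j; rewrite !mxE expr0 mul1r.
case: eqP => [->|/eqP ji].
  by rewrite tpermL xz /t; field.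
case: eqP => [->|/eqP jz].
  by rewrite tpermR xz /t; field.
by rewrite tpermD 1?eq_sym //; ring.
Qed.

(** Transferring to the zero coordinates one after the other avoids convex
    combinations of more than two points. *)
Lemma one_symmetric_spread (R : realType) (n : nat) (B : set 'rV[R]_n)
    (x : 'rV[R]_n) (i : 'I_n) (zs : seq 'I_n) (s : R) :
  convex_set (B : set (convex_lmodType 'rV[R]_n)) -> one_symmetric B ->
  B x -> uniq zs -> (forall z, z \in zs -> x ord0 z = 0) ->
  0 < x ord0 i -> 0 < s -> s *+ size zs <= x ord0 i ->
  B (\row_j (if j == i then x ord0 i - s *+ size zs else
             if j \in zs then s else x ord0 j)).
Proof.
move=> cB sB Bx + + xi s0.
elim: zs => [|z zs IH] /=.
  move=> _ _ _; congr (B _): Bx; apply/rowP => j; rewrite mxE mulr0n subr0.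
  by case: eqP => [->|].
case/andP=> z_zs u_zs zs0; rewrite mulrS => s_le.
have zz : x ord0 z = 0 by apply: zs0; rewrite mem_head.
have zi : (z == i) = false by apply/eqP => zi; move: xi; rewrite -zi zz ltxx.
have zs0' k : k \in zs -> x ord0 k = 0.
  by move=> kzs; apply: zs0; rewrite inE kzs orbT.
have {}IH := IH u_zs zs0' ltac:(lra).
set y := (\row_j _) in IH.
have yi : y ord0 i = x ord0 i - s *+ size zs by rewrite mxE eqxx.
have yz : y ord0 z = 0 by rewrite mxE zi (negbTE z_zs).
have := one_symmetric_transfer (i := i) (s := s) cB sB IH yz.
rewrite yi => /(_ ltac:(lra) ltac:(lra) ltac:(lra)).
congr (B _); apply/rowP => j; rewrite !mxE inE.
case: (eqVneq j i) => [_|_]; first by ring.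
by case: (eqVneq j z).
Qed.

(** * Illumination by directions matching the support *)

(** The bound [delta < n^-1] leaves room for a mass [e / n > e * delta] on each
    of the at most [n - 1] zero coordinates, at a cost to coordinate [i] that
    stays below the [e] by which the direction lowers it. *)
Lemma illuminates_support (R : realType) (n : nat) (B : set 'rV[R]_n)
    (x d : 'rV[R]_n) (i : 'I_n) (delta : R) :
  convex_set (B : set (convex_lmodType 'rV[R]_n)) -> one_symmetric B ->
  B x -> 0 < delta -> delta < n%:R^-1 ->
  x ord0 i != 0 -> `|d ord0 i| = 1 ->
  (forall j, j != i -> `|d ord0 j| = delta) ->
  (forall j, x ord0 j != 0 -> (d ord0 j < 0) = (0 < x ord0 j)) ->
  illuminates_point B d x.
Proof.
move=> cB sB Bx delta0 delta_n xi di dj dx.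
(* A step up to the least nonzero modulus flips no sign on the support. *)
pose e := \big[Order.min/1]_(j | x ord0 j != 0) `|x ord0 j|.
have e0 : 0 < e by apply: lt_bigmin => // j; rewrite normr_gt0.
have e_le j : x ord0 j != 0 -> e <= `|x ord0 j|.
  by move=> xj; apply: bigmin_le_cond.
have n0 : (0 < n)%N by case: (n) i {di dj xi} => // -[].
have nR0 : 0 < n%:R :> R by rewrite ltr0n.
have n1 : n%:R^-1 <= 1 :> R by rewrite invf_le1 // ler1n.
exists e => //.
(* Passing to absolute values makes coordinate [i] positive, as required to
   take mass from it. *)
pose x' := \row_j `|x ord0 j|.
have Bx' : B x'.
  by apply: (one_symmetric_solid cB sB Bx) => j; rewrite mxE normr_id.
pose zs := enum [pred j | x ord0 j == 0].
have zs_mem j : (j \in zs) = (x ord0 j == 0) by rewrite mem_enum.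
have size_zs : (size zs < n)%N.
  rewrite -cardE -[ltnRHS]card_ord; apply: proper_card; apply/properP; split.
    exact/subset_predT.
  by exists i.
have small : (e / n%:R) *+ size zs < e.
  by rewrite -mulr_natr mulrAC ltr_pdivrMr // ltr_pM2l // ltr_nat.
have xi_ge := e_le i xi.
have xi0 : 0 < x' ord0 i by rewrite mxE normr_gt0.
have zs0 z : z \in zs -> x' ord0 z = 0.
  by rewrite zs_mem mxE => /eqP ->; rewrite normr0.
have xi_large : e / n%:R *+ size zs <= x' ord0 i by rewrite mxE; lra.
have Bw :=
  one_symmetric_spread cB sB Bx' (enum_uniq _) zs0 xi0 (divr_gt0 e0 nR0)
    xi_large.
apply: (one_symmetric_interior_box cB sB Bw) => j.
have d_nz : 0 < `|d ord0 j| <= 1.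
  have [->|/dj ->] := eqVneq j i; first by rewrite di ltr01 lexx.
  by rewrite delta0 ltW // (lt_le_trans delta_n).
have norm_move : x ord0 j != 0 ->
    `|x ord0 j + e * d ord0 j| = `|x ord0 j| - e * `|d ord0 j|.
  move=> xj; have := e_le j xj; have := dx j xj.
  have : e * `|d ord0 j| <= e by rewrite ger_pMr //; case/andP: d_nz.
  move: xj d_nz; rewrite neq_lt => /orP[] xj /andP[d1 d2].
    rewrite (lt_gtF xj) (ltr0_norm xj) => le1 /negbT; rewrite -leNgt => d_ge0.
    by rewrite (ger0_norm d_ge0) in le1 * => le2; rewrite ler0_norm; lra.
  rewrite xj (gtr0_norm xj) => le1 d_lt0.
  by rewrite (ltr0_norm d_lt0) in le1 * => le2; rewrite ger0_norm; lra.
rewrite !mxE zs_mem.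
case: (eqVneq j i) => [ji|ji].
  rewrite ji in norm_move *; rewrite norm_move // di mulr1.
  by rewrite [ltRHS]ger0_norm; lra.
case: (eqVneq (x ord0 j) 0) => [->|xj].
  rewrite add0r normrM (dj j ji) !ger0_norm ?(ltW e0) // ?ltr_pM2l //.
  by rewrite divr_ge0 // ltW.
rewrite norm_move // normr_id; case/andP: d_nz => d1 _.
by have := mulr_gt0 e0 d1; lra.
Qed.

(** * The illuminating set *)

Definition run_direction (R : realType) (n : nat) (delta : R)
    (s : {ffun 'I_n.+1 -> bool}) : 'rV[R]_n.+1 :=
  \row_j ((-1) ^+ s j * (if j == run_end s then 1 else delta)).

Lemma run_direction_lt0 (R : realType) (n : nat) (delta : R)
    (s : {ffun 'I_n.+1 -> bool}) (j : 'I_n.+1) : 0 < delta ->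
  (run_direction delta s ord0 j < 0) = s j.
Proof.
move=> delta0; rewrite mxE.
have : 0 < if j == run_end s then 1 else delta by case: ifP.
case: (s j) => p0; first by rewrite expr1 mulN1r oppr_lt0.
by rewrite expr0 mul1r; apply/negbTE; rewrite -leNgt ltW.
Qed.

Lemma card_range_ffun (T : Type) (n : nat) (f : {ffun 'I_n -> bool} -> T) :
  injective f -> (range f #= `I_(2 ^ n)%N)%card.
Proof.
move=> f_inj.
apply: (@card_eq_trans _ _ _ _ [set: {ffun 'I_n -> bool}]).
  by apply: inj_card_eq => s t _ _; apply: f_inj.
rewrite card_eq_sym.
have <- : [set (enum_rank s : nat) | s in [set: {ffun 'I_n -> bool}]]
    = `I_(2 ^ n)%N.
  have cardE : #|{ffun 'I_n -> bool}| = (2 ^ n)%N.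
    by rewrite card_ffun card_bool card_ord.
  rewrite -cardE; apply/seteqP; split => [_ [s _ <-]|k /= kn] /=.
    exact: ltn_ord.
  by exists (enum_val (Ordinal kn)); rewrite ?enum_valK.
by apply: inj_card_eq => s t _ _ /val_inj/enum_rank_inj.
Qed.

Unset Implicit Arguments.

Theorem theoremD (R : realType) (n : nat) (hn : (2 <= n)%N) :
  exists I : set 'rV[R]_n,
    [/\ I `<=` Gset n (1 / (n%:R + 1)),
        (I #= `I_(2 ^ n)%N)%card
      & forall B : set 'rV[R]_n,
          convex_body B -> one_symmetric B -> illuminates I B].
Proof.
case: n hn => // n _.
have n0 : 0 < n.+1%:R :> R by rewrite ltr0n.
set delta : R := 1 / (n.+1%:R + 1).
have delta0 : 0 < delta by rewrite divr_gt0 // addr_gt0.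
have delta_n : delta < n.+1%:R^-1.
  by rewrite /delta div1r ltf_pV2 ?posrE ?addr_gt0 // ltrDl.
have normE (s : {ffun 'I_n.+1 -> bool}) j : `|run_direction delta s ord0 j| =
    if j == run_end s then 1 else delta.
  rewrite mxE normrM normr_sign mul1r ger0_norm //.
  by case: ifP => // _; apply: ltW.
exists (range (run_direction delta)); split.
- move=> _ [s _ <-]; exists (run_end s).
  by split=> [|j /negbTE ji]; rewrite normE ?eqxx ?ji.
- apply: card_range_ffun => s t st; apply/ffunP => j.
  by rewrite -!(run_direction_lt0 _ j delta0) st.
move=> B bB sB; split=> [_ [s _ <-]|x [x_cl x_nint]].
  apply/eqP => /rowP/(_ (run_end s)) d0.
  have := normE s (run_end s); rewrite d0 mxE normr0 eqxx => /eqP.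
  by rewrite eq_sym oner_eq0.
have [compB cB _] := bB.
have Bx : B x by apply: compact_closed x_cl => //; apply: norm_hausdorff.
have [k xk] : exists k, x ord0 k != 0.
  apply: contrapT => x0; apply: x_nint.
  suff -> : x = 0 by apply: one_symmetric_interior0.
  apply/rowP => j; rewrite mxE; apply/eqP; apply: contrapT => xj.
  by apply: x0; exists j; apply/negP.
have [s [s_ext s_run]] :=
  extend_with_run_end_in (S := fun j => x ord0 j != 0)
    (fun j => 0 < x ord0 j) xk.
exists (run_direction delta s); first by exists s.
apply: (illuminates_support (i := run_end s) (delta := delta)) => //.
- by rewrite normE eqxx.
- by move=> j /negbTE ji; rewrite normE ji.
- by move=> j xj; rewrite run_direction_lt0 // s_ext.
Qed.
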